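(* Let $h=(1,h_1,\dots,h_e)$ be a Gorenstein $h$-vector of codimension $3$ (so $h_1=3$), i.e. $h$ is the $h$-vector of some standard graded artinian Gorenstein algebra $A=R/I$ of codimension $3$, where $R=k[x_1,x_2,x_3]$, $k$ is any field, and $e$ is the socle degree of $A$. Then $h$ is an SI-sequence; that is, $h_i=h_{e-i}$ for all $0\le i\le e$, and the first half $(1,h_1,\dots,h_{\lfloor e/2\rfloor})$ of $h$ is differentiable, i.e. its first difference $$(1,\,h_1-1,\,h_2-h_1,\,\dots,\,h_{\lfloor e/2\rfloor}-h_{\lfloor e/2\rfloor-1})$$ is an $O$-sequence.
   Context: Algebras: consider standard graded artinian algebras $A=R/I$, where $R=k[x_1,\dots,x_r]$, $k$ is any field, every $x_i$ has degree $1$, and $I$ is a homogeneous ideal of $R$ containing no non-zero forms of degree $1$. The $h$-vector of $A$ is $h(A)=(h_0,h_1,\dots,h_e)$, where $h_i=\dim_k A_i$ and $e$ is the last index with $\dim_k A_e>0$. The codimension of $A$ is $r=h_1$, and $e$ is called the socle degree of $A$ (or of $h(A)$). Gorenstein: the socle of $A$ is $soc(A)=\{a\in A \mid a\overline{m}=0\}$, where $\overline{m}=(\overline{x_1},\dots,\overline{x_r})\subset A$ is the maximal homogeneous ideal. It is a homogeneous ideal; the socle-vector of $A$ is $(s_0,s_1,\dots,s_e)$ with $s_i=\dim_k soc(A)_i$. The algebra $A$ is Gorenstein if its socle-vector is $(0,0,\dots,0,s_e=1)$. A Gorenstein $h$-vector is the $h$-vector of a Gorenstein algebra of this kind; its codimension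 is that of the algebra, namely $h_1$. Binomial expansions: for positive integers $n$ and $i$, the $i$-binomial expansion of $n$ is the unique expression $$n=\binom{n_i}{i}+\binom{n_{i-1}}{i-1}+\dots+\binom{n_j}{j},\qquad n_i>n_{i-1}>\dots>n_j\ge j\ge 1,$$ and one defines $$n^{<i>}=\binom{n_i+1}{i+1}+\binom{n_{i-1}+1}{i-1+1}+\dots+\binom{n_j+1}{j+1}.$$ By convention $0^{<i>}=0$. $O$-sequences: a sequence of non-negative integers $(c_0,c_1,\dots,c_d)$ with $c_0=1$ is an $O$-sequence if $c_{t+1}\le c_t^{<t>}$ for every $1\le t\le d-1$. Differentiable vectors: a vector of non-negative integers $v=(v_0=1,v_1,\dots,v_d)$ is differentiable if its first difference $\Delta v=(1,v_1-v_0,\dots,v_d-v_{d-1})$ is an $O$-sequence (in particular all its entries are non-negative). SI-sequences: an $h$-vector $h=(1,h_1,\dots,h_e)$ is an SI-sequence if it is symmetric with respect to $e/2$ (i.e. $h_i=h_{e-i}$ for all $i$) and its first half $(1,h_1,\dots,h_{\lfloor e/2\rfloor})$ is differentiable. Here $\lfloor x\rfloor$ is the largest integer less than or equal to $x$. *)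

(* Defs.v *)
From HB Require Import structures.
From mathcomp Require Import all_boot all_order all_algebra.
From mathcomp Require Import ring_quotient mpoly zify.

Set Implicit Arguments.
Unset Strict Implicit.
Unset Printing Implicit Defensive.

Import Order.TTheory GRing.Theory.

(* [s] lists n_i, n_(i-1), ..., n_j in this order, so j = i - (size s).-1; for
   n = 0 the list is empty. *)
Definition is_binexp (i n : nat) (s : seq nat) : bool :=
  [&& size s <= i, sorted gtn s, i - (size s).-1 <= last i s
    & n == \sum_(t < size s) 'C(nth 0 s t, i - t)].

Lemma is_binexp_cons i n m s :
  is_binexp i.+1 n (m :: s) =
  [&& path gtn m s, i < m, 'C(m, i.+1) <= n & is_binexp i (n - 'C(m, i.+1)) s].
Proof.
rewrite /is_binexp /= big_ord_recl /= subn0.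
under eq_bigr => t _ do rewrite /bump /= add1n subSS.
rewrite ltnS; move: (\sum_(_ < _) _) => S.
case: s => [|x s] /=.
  by apply/idP/idP; lia.
rewrite subSS; set L := last x s; case hp: (path gtn x s) => /=;
  last by rewrite !andbF.
have hL : L + size s <= x.
  by rewrite /L; elim: s x hp {L} => [|y s IH] x /=; [lia | move=> /andP[? /IH]; lia].
rewrite !andbT; apply/idP/idP => [/and4P[a b c /eqP d] | ].
  by apply/and4P; split=> //; [lia | lia | apply/and3P; split=> //; lia].
move=> /and4P[a b c /and3P[d e /eqP f]].
by apply/and4P; split=> //; lia.
Qed.

Lemma is_binexp_nil i n : is_binexp i n [::] = (n == 0).
Proof. by rewrite /is_binexp /= big_ord0 subn0 leqnn. Qed.

Lemma binexp_exists_below i M n :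
  n < 'C(M, i) -> exists2 s, is_binexp i n s & path gtn M s.
Proof.
elim: i M n => [|i IH] M n.
  by rewrite bin0 ltnS leqn0 => /eqP->; exists [::]; rewrite ?is_binexp_nil.
case: n => [|n] hn; first by exists [::]; rewrite ?is_binexp_nil.
have [||m hm maxm] := @ex_maxnP (fun m => 'C(m, i.+1) <= n.+1) M.
- by exists 0; rewrite bin0n.
- move=> j hj; rewrite leqNgt; apply/negP => Mj.
  by have := leq_bin2l i.+1 (ltnW Mj); lia.
have hm1 : n.+1 < 'C(m.+1, i.+1).
  by rewrite ltnNge; apply/negP => /maxm; rewrite ltnn.
have im : i < m by apply: maxm; rewrite binn.
have mM : m < M.
  rewrite ltnNge; apply/negP => Mm.
  by have := leq_bin2l i.+1 Mm; lia.
have [|s hs ps] := IH m (n.+1 - 'C(m, i.+1)).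
  by move: hm1; rewrite binS; lia.
exists (m :: s); last by rewrite /= ps andbT.
by rewrite is_binexp_cons ps im hm.
Qed.

Lemma binexp_exists i n : exists s, is_binexp i.+1 n s.
Proof.
have [|s hs _] := @binexp_exists_below i.+1 (n + i.+1) n; last by exists s.
elim: n => [|n IH]; first by rewrite binn.
rewrite addSn binS; have : 0 < 'C(n + i.+1, i) by rewrite bin_gt0; lia.
lia.
Qed.

Lemma is_binexp_bounds i n m s :
  is_binexp i.+1 n (m :: s) -> 'C(m, i.+1) <= n < 'C(m.+1, i.+1).
Proof.
elim: i n m s => [|i IH] n m s; rewrite is_binexp_cons => /and4P[hp him hle].
  case: s hp => [|x s] _; last by rewrite /is_binexp.
  by rewrite is_binexp_nil !bin1 in hle *; lia.
rewrite hle binS /=; case: s hp => [_|x s /= /andP[xm _]].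
  rewrite is_binexp_nil => /eqP h.
  have : 0 < 'C(m, i.+1) by rewrite bin_gt0; lia.
  lia.
move=> /IH /andP[_ h]; have := leq_bin2l i.+1 xm; lia.
Qed.

Lemma is_binexp_uniq i n s1 s2 :
  is_binexp i n s1 -> is_binexp i n s2 -> s1 = s2.
Proof.
have pos j p m s : is_binexp j p (m :: s) -> 0 < p.
  case: j => [|j]; first by rewrite /is_binexp.
  rewrite is_binexp_cons => /and4P[_ h1 h2 _].
  by apply: leq_trans h2; rewrite bin_gt0.
elim: s1 i n s2 => [|m1 s1 IH] i n [|m2 s2] //.
- by rewrite is_binexp_nil => /eqP n0 /pos; rewrite n0.
- by rewrite is_binexp_nil => /pos npos /eqP n0; rewrite n0 in npos.
case: i => [|i]; first by rewrite /is_binexp.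
move=> h1 h2.
have /andP[a1 b1] := is_binexp_bounds h1.
have /andP[a2 b2] := is_binexp_bounds h2.
have e : m1 = m2.
  apply/eqP; rewrite eqn_leq; apply/andP; split; rewrite leqNgt; apply/negP => h.
    by have := leq_bin2l i.+1 h; lia.
  by have := leq_bin2l i.+1 h; lia.
move: h1 h2; rewrite -e !is_binexp_cons => /and4P[_ _ _ h1] /and4P[_ _ _ h2].
by rewrite (IH _ _ _ h1 h2).
Qed.

(* The expansion only makes sense for i > 0; the value at i = 0 is a dummy. *)
Definition binexp (i n : nat) : seq nat :=
  if i is i'.+1 then xchoose (binexp_exists i' n) else [::].

Lemma binexpP i n : 0 < i -> is_binexp i n (binexp i n).
Proof. by case: i => // i _; apply: (xchooseP (binexp_exists i n)). Qed.

(* n^{<i>}; in particular 0^{<i>} = 0. *)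
Definition macaulay_up (n i : nat) : nat :=
  \sum_(t < size (binexp i n)) 'C((nth 0 (binexp i n) t).+1, (i - t).+1).

Definition O_sequence (c : seq nat) : Prop :=
  nth 0 c 0 = 1 /\
  forall t, 0 < t -> t.+1 < size c ->
    nth 0 c t.+1 <= macaulay_up (nth 0 c t) t.

(* Differences are taken in [int], since subtraction on [nat] is truncated. *)
Definition first_difference (v : seq nat) : seq int :=
  pairmap (fun a b : nat => b%:Z - a%:Z)%R 0 v.

Definition differentiable_seq (v : seq nat) : Prop :=
  nth 0 v 0 = 1 /\
  exists2 c : seq nat, first_difference v = map Posz c & O_sequence c.

Definition SI_sequence (h : seq nat) : Prop :=
  let e := (size h).-1 in
  (forall i, i <= e -> nth 0 h i = nth 0 h (e - i)) /\
  differentiable_seq (take e./2.+1 h).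

Local Open Scope ring_scope.
Local Open Scope quotient_scope.

Definition has_dim (k : fieldType) (V : lmodType k) (S : V -> Prop) (n : nat)
    : Prop :=
  exists b : 'I_n -> V,
    [/\ forall i, S (b i),
        forall c : 'I_n -> k, \sum_i c i *: b i = 0 -> forall i, c i = 0
      & forall v, S v -> exists c : 'I_n -> k, v = \sum_i c i *: b i].

Definition is_ideal (A : comNzRingType) (J : {pred A}) : Prop :=
  0 \in J /\ forall a, {in J &, forall u v, a * u + v \in J}.

Definition artinian (A : comNzRingType) : Prop :=
  forall J : nat -> {pred A},
    (forall n, is_ideal (J n)) -> (forall n, {subset J n.+1 <= J n}) ->
    exists N, forall n, (N <= n)%N -> J n =i J N.

Section QuotientAlgebra.
Variables (k : fieldType) (r : nat) (I : idealr {mpoly k[r]}).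

(* R/I with R = k[x_1,...,x_r]; the alias carries the k-module structure that
   the library does not put on [{ideal_quot I}]. *)
Definition quot_alg : Type := {ideal_quot I}.

HB.instance Definition _ := GRing.ComNzRing.on quot_alg.

Definition qproj (p : {mpoly k[r]}) : quot_alg := \pi_({ideal_quot I}) p.

Lemma qproj_zmod_morphism : zmod_morphism qproj.
Proof. exact: (rmorphB (\pi_({ideal_quot I}))). Qed.

Lemma qproj_monoid_morphism : monoid_morphism qproj.
Proof.
exact: (conj (rmorph1 (\pi_({ideal_quot I}))) (rmorphM (\pi_({ideal_quot I})))).
Qed.

HB.instance Definition _ :=
  GRing.isZmodMorphism.Build {mpoly k[r]} quot_alg qproj qproj_zmod_morphism.
HB.instance Definition _ :=
  GRing.isMonoidMorphism.Build {mpoly k[r]} quot_alg qproj qproj_monoid_morphism.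

Lemma qproj_eq0 p : (qproj p == 0) = (p \in I).
Proof.
by rewrite -(rmorph0 qproj) /qproj; have := Quotient.idealrBE I p 0; rewrite subr0 => ->.
Qed.

Definition qscale (c : k) (a : quot_alg) : quot_alg := qproj c%:MP * a.

Lemma qscaleA c d a : qscale c (qscale d a) = qscale (c * d) a.
Proof. by rewrite /qscale mulrA -rmorphM -mpolyCM. Qed.

Lemma qscale1 : left_id 1 qscale.
Proof. by move=> a; rewrite /qscale mpolyC1 rmorph1 mul1r. Qed.

Lemma qscaleDr : right_distributive qscale +%R.
Proof. by move=> c a b; rewrite /qscale mulrDr. Qed.

Lemma qscaleDl a : {morph qscale^~ a : c d / c + d}.
Proof. by move=> c d; rewrite /qscale mpolyCD rmorphD mulrDl. Qed.

HB.instance Definition _ := GRing.Zmodule_isLmodule.Build k quot_alg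
  qscaleA qscale1 qscaleDr qscaleDl.

Definition homogeneous_ideal : Prop :=
  forall p, p \in I -> forall d, pihomog mdeg d p \in I.

Definition no_linear_forms : Prop :=
  forall p, p \is 1.-homog -> p \in I -> p = 0.

Definition graded_piece (d : nat) (a : quot_alg) : Prop :=
  exists2 p : {mpoly k[r]}, p \is d.-homog & a = qproj p.

Definition max_homog_ideal (a : quot_alg) : Prop :=
  exists c : 'I_r -> quot_alg, a = \sum_i c i * qproj 'X_i.

Definition socle (a : quot_alg) : Prop :=
  forall b, max_homog_ideal b -> a * b = 0.

(* As [h] is padded with zeros by [nth], its last index e is the largest
   degree in which R/I does not vanish. *)
Definition is_hvector (h : seq nat) : Prop :=
  last 0%N h != 0%N /\ forall i, has_dim (graded_piece i) (nth 0%N h i).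

Definition is_socle_vector (s : seq nat) : Prop :=
  exists h, [/\ is_hvector h, size s = size h
    & forall i, (i < size s)%N ->
        has_dim (fun a => graded_piece i a /\ socle a) (nth 0%N s i)].

Definition gorenstein : Prop :=
  exists e : nat, is_socle_vector (rcons (nseq e 0%N) 1%N).

End QuotientAlgebra.

Definition gorenstein_hvector (k : fieldType) (r : nat) (h : seq nat) : Prop :=
  exists I : idealr {mpoly k[r]},
    [/\ homogeneous_ideal I, no_linear_forms I, artinian (quot_alg I),
        gorenstein I & is_hvector I h].

(* Main.v *)
(* A Gorenstein algebra A of socle degree e is determined by a linear form
   phi on the polynomials of degree e, and h_d is the rank of the catalecticant
   matrix (phi(m m')) with m, m' running over the monomials of degrees d and
   e - d. Hence h is symmetric, and so, for a linear form L, is the vector of the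
   dimensions b_d of L A_d (with respect to (e - 1)/2), because
   A/(0 : L) is Gorenstein of socle degree e - 1. With c_d = dim (A/LA)_d, the
   two symmetries give h_d - h_(d-1) = c_d - c_(e+1-d).

   Let t be the initial degree of I and f a nonzero form of degree t in I. If L and U
   are independent linear forms through a point where f does not vanish, then
   A_d = L A_(d-1) + U A_(d-1) for d >= t, so U maps (A/LA)_(d-1) onto (A/LA)_d
   and c_d <= c_(d-1). So the differences of h are 1, 2, ..., t and are
   nonincreasing and nonnegative from then on, up to degree e/2.

   Over a finite field such a point may not exist; as ranks are invariant under
   field extension, the point (1 : X : X^(e+1)) over k(X) can be used. *)

Require Import Defs.
From mathcomp Require Import all_boot all_order all_algebra.
From mathcomp Require Import ring_quotient mpoly zify.

Set Implicit Arguments.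
Unset Strict Implicit.
Unset Printing Implicit Defensive.

Import Order.TTheory GRing.Theory.

(** * Ranks of quotients of row spaces *)

Section RankDrop.
Local Open Scope ring_scope.

(** [U] induces a map from [A] modulo [B] to vectors modulo [B']: it is well defined because
    [B *m U] lies in [B'], and its image covers [A']. A complement of [B] in [A] therefore suffices
    to reach [A'] modulo [B']. *)
Lemma rank_drop_le (F : fieldType) (n : nat) (A A' B B' U : 'M[F]_n) :
  (B <= A)%MS -> (A' <= B' + A *m U)%MS -> (B *m U <= B')%MS ->
  (\rank A' + \rank B <= \rank A + \rank B')%N.
Proof.
move=> sBA sA' sBU.
have /eqmxP eA := addsmx_diff_cap_eq A B.
have sA2 : (A' <= B' + (A :\: B)%MS *m U)%MS.
  apply: submx_trans sA' _; rewrite addsmx_sub addsmxSl /=.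
  have /andP[_ /(submxMr U)] := eA; rewrite addsmxMr => /submx_trans; apply.
  rewrite addsmx_sub addsmxSr /= (submx_trans _ (addsmxSl _ _)) //.
  exact: submx_trans (submxMr U (capmxSr _ _)) sBU.
have h1 := mxrankS sA2.
have h2 := mxrank_adds_leqif B' ((A :\: B)%MS *m U).
have h3 := mxrankM_maxl (A :\: B)%MS U.
have h4 := mxrank_cap_compl A B.
have h5 : (\rank B <= \rank (A :&: B))%N by rewrite mxrankS // sub_capmx sBA submx_refl.
have := h2.1; lia.
Qed.

End RankDrop.

(** * Catalecticant matrices *)

Section Catalecticant.
Local Open Scope ring_scope.

Variables (K : fieldType) (e : nat) (phi : 'X_{1..3} -> K).

(** One index set serves all degrees, so every map is a square matrix of the same size and graded
    pieces are cut out by [degproj]. *)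
Let n := #|{: 'X_{1..3 < e.+1}}|.

Definition mon (i : 'I_n) : 'X_{1..3} := bmnm (enum_val i).

Definition monv (m : 'X_{1..3}) : 'rV[K]_n := \row_i (mon i == m)%:R.

Definition degproj (d : nat) : 'M[K]_n :=
  \matrix_(i, j) ((i == j) && (mdeg (mon i) == d))%:R.

(* Matrices act on row vectors; products of degree > e are sent to 0. *)
Definition mulvar (j : 'I_3) : 'M[K]_n :=
  \matrix_(a, b) ((mon a + U_(j))%MM == mon b)%:R.

(* All catalecticants in one square matrix: the rows of degree d are the
   catalecticant of phi of type (d, e - d), padded with zeros. *)
Definition catmx : 'M[K]_n :=
  \matrix_(a, b) (if (mdeg (mon a) + mdeg (mon b) == e)%N
                  then phi (mon a + mon b)%MM else 0).

Lemma mdeg_mon i : (mdeg (mon i) <= e)%N.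
Proof. by rewrite -ltnS /mon; case: (enum_val i). Qed.

Lemma mon_inj : injective mon.
Proof. by move=> i j /val_inj/enum_val_inj. Qed.

Lemma mon_surj m : (mdeg m <= e)%N -> exists i, mon i = m.
Proof.
move=> hm; have hm' : (mdeg m < e.+1)%N by [].
by exists (enum_rank (BMultinom hm')); rewrite /mon enum_rankK.
Qed.

Lemma monvE i : monv (mon i) = delta_mx 0 i.
Proof. by apply/rowP=> j; rewrite !mxE (inj_eq mon_inj). Qed.

Lemma monv_gt m : (e < mdeg m)%N -> monv m = 0.
Proof.
move=> hm; apply/rowP=> j; rewrite !mxE; case: eqP => // hj.
by move: (mdeg_mon j); rewrite hj leqNgt hm.
Qed.

Lemma monv_cases m : (exists2 i, m = mon i & (mdeg m <= e)%N) \/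
  (e < mdeg m)%N /\ monv m = 0.
Proof.
case: (leqP (mdeg m) e) => hm; last by right; rewrite monv_gt.
by left; have [i <-] := mon_surj hm; exists i; rewrite ?mdeg_mon.
Qed.

Lemma monv_ext (p : nat) (A B : 'M[K]_(n, p)) :
  (forall m, monv m *m A = monv m *m B) -> A = B.
Proof. by move=> h; apply/row_matrixP=> i; rewrite !rowE -monvE h. Qed.

Lemma monv_ext2 (A B : 'M[K]_n) :
  (forall m m', (mdeg m <= e)%N -> (mdeg m' <= e)%N ->
   monv m *m A *m (monv m')^T = monv m *m B *m (monv m')^T) -> A = B.
Proof.
move=> h; apply/row_matrixP=> i; rewrite !rowE -monvE.
apply/trmx_inj/row_matrixP => j; rewrite !rowE -monvE.
by apply/trmx_inj; rewrite !trmx_mul !trmxK h ?mdeg_mon.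
Qed.

Lemma monv_degproj m d : monv m *m degproj d = (mdeg m == d)%:R *: monv m.
Proof.
have [[i -> _]|[_ ->]] := monv_cases m; last by rewrite mul0mx scaler0.
rewrite monvE -rowE; apply/rowP=> j; rewrite !mxE /=.
by rewrite eq_sym; do 2!case: eqP => _; rewrite /= ?mulr0 ?mulr1 ?mul0r.
Qed.

Lemma monv_mulvar m j : monv m *m mulvar j = monv (m + U_(j))%MM.
Proof.
have [[i -> _]|[hm ->]] := monv_cases m.
  by rewrite monvE -rowE; apply/rowP=> b; rewrite !mxE eq_sym.
by rewrite mul0mx monv_gt // mdegD; lia.
Qed.

Lemma monv_catmx m m' : monv m *m catmx *m (monv m')^T =
  (if (mdeg m + mdeg m' == e)%N then phi (m + m')%MM else 0)%:M.
Proof.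
have [[i -> _]|[hm ->]] := monv_cases m; last first.
  by rewrite !mul0mx; case: eqP => [|_]; [lia | rewrite raddf0].
have [[j -> _]|[hm ->]] := monv_cases m'; last first.
  by rewrite trmx0 mulmx0; case: eqP => [|_]; [lia | rewrite raddf0].
rewrite !monvE -rowE trmx_delta -colE; apply/matrixP=> a b.
by rewrite !ord1 !mxE.
Qed.

Lemma catmx_tr : catmx^T = catmx.
Proof. by apply/matrixP=> a b; rewrite !mxE addnC addmC. Qed.

Lemma degproj_tr d : (degproj d)^T = degproj d.
Proof.
by apply/matrixP=> a b; rewrite !mxE eq_sym; case: eqP => // ->.
Qed.

Lemma degproj_catmx d : (d <= e)%N ->
  degproj d *m catmx = catmx *m degproj (e - d).
Proof.
move=> hd; apply: monv_ext2 => m m' _ _.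
rewrite mulmxA monv_degproj -!scalemxAl mulmxA -[in RHS]mulmxA.
rewrite -[degproj (e - d)]degproj_tr -trmx_mul monv_degproj linearZ /= -scalemxAr.
rewrite monv_catmx; case: (altP ((mdeg m + mdeg m')%N =P e)) => he; last by rewrite !raddf0.
by congr (_%:R *: _); apply/eqP/eqP; lia.
Qed.

(** Multiplication by a variable is self-adjoint for the pairing: both sides evaluate phi at m x_j
    m'. *)
Lemma mulvar_catmx j : mulvar j *m catmx = catmx *m (mulvar j)^T.
Proof.
apply: monv_ext2 => m m' _ _.
rewrite mulmxA monv_mulvar mulmxA -[in RHS]mulmxA -trmx_mul monv_mulvar.
by rewrite !monv_catmx !mdegD mdeg1 -addmA [(U_(j) + m')%MM]addmC addnAC addnA.
Qed.

Lemma mulvarC i j : mulvar i *m mulvar j = mulvar j *m mulvar i.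
Proof.
by apply: monv_ext => m; rewrite !mulmxA !monv_mulvar -!addmA [(U_(i) + _)%MM]addmC.
Qed.

Lemma degproj_mulvar d j : degproj d *m mulvar j = mulvar j *m degproj d.+1.
Proof.
apply: monv_ext => m; rewrite !mulmxA monv_degproj -scalemxAl monv_mulvar.
by rewrite monv_degproj mdegD mdeg1 addn1 eqSS.
Qed.

Lemma mulvar_degproj0 j : mulvar j *m degproj 0 = 0.
Proof.
apply: monv_ext => m; rewrite mulmxA monv_mulvar monv_degproj mdegD mdeg1 addn1.
by rewrite scale0r mulmx0.
Qed.

End Catalecticant.

(** * Quotient by a linear form *)

Section LinearForms.
Local Open Scope ring_scope.

Local Notation x0 := (@Ordinal 3 0 isT).
Local Notation x1 := (@Ordinal 3 1 isT).
Local Notation x2 := (@Ordinal 3 2 isT).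

Lemma mdeg3 (m : 'X_{1..3}) : mdeg m = (m x0 + m x1 + m x2)%N.
Proof.
rewrite mdegE !big_ord_recr big_ord0 /= add0n.
by congr (_ + _ + _)%N; congr (m _); apply/val_inj.
Qed.

Lemma mnm3P (m m' : 'X_{1..3}) :
  m x0 = m' x0 -> m x1 = m' x1 -> m x2 = m' x2 -> m = m'.
Proof.
move=> h0 h1 h2; apply/mnmP => -[[|[|[|//]]] hi].
- by rewrite (_ : Ordinal hi = x0) //; apply/val_inj.
- by rewrite (_ : Ordinal hi = x1) //; apply/val_inj.
- by rewrite (_ : Ordinal hi = x2) //; apply/val_inj.
Qed.

Variables (K : fieldType) (e : nat) (phi : 'X_{1..3} -> K) (p q : K).

Let n := #|{: 'X_{1..3 < e.+1}}|.
(** Vectors killed by [C] are the relations of A. So the row space of [P d *m C] is a copy of A_d,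
    and that of [linform a j *m P d *m C] a copy of L A_(d-1). *)
Let C : 'M[K]_n := catmx e phi.
Let P : nat -> 'M[K]_n := @degproj K e.

Definition linform (a : K) (j : 'I_3) : 'M[K]_n :=
  mulvar K e j - a *: mulvar K e x0.

Lemma linform_catmx a j : linform a j *m C = C *m (linform a j)^T.
Proof.
have -> : (linform a j)^T = (mulvar K e j)^T - a *: (mulvar K e x0)^T.
  by rewrite linearB linearZ.
by rewrite /linform mulmxBl mulmxBr -scalemxAl -scalemxAr !mulvar_catmx.
Qed.

Lemma linformC a i b j : linform a i *m linform b j = linform b j *m linform a i.
Proof.
rewrite /linform !mulmxBl !mulmxBr -!scalemxAl -!scalemxAr.
rewrite (mulvarC _ _ i j) (mulvarC _ _ i x0) (mulvarC _ _ x0 j) !scalerA [a * b]mulrC.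
by rewrite !opprB !addrA [LHS]addrAC [RHS]addrAC; congr (_ + _); rewrite addrAC.
Qed.

Lemma degproj_linform d a j : P d *m linform a j = linform a j *m P d.+1.
Proof.
by rewrite /linform mulmxBl mulmxBr -scalemxAl -scalemxAr !degproj_mulvar.
Qed.

Lemma linform_degproj0 a j : linform a j *m P 0 = 0.
Proof. by rewrite /linform mulmxBl -scalemxAl !mulvar_degproj0 scaler0 subr0. Qed.

Lemma degproj_gt d : (e < d)%N -> P d = 0.
Proof.
move=> hd; apply: monv_ext => m; rewrite monv_degproj mulmx0.
have [[i -> _]|[_ ->]] := monv_cases K e m; last by rewrite scaler0.
by case: eqP => h; [have := mdeg_mon i; lia | rewrite scale0r].
Qed.

Lemma catmx_degproj d : (d <= e)%N -> C *m P d = P (e - d) *m C.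
Proof.
move=> hd; rewrite degproj_catmx; last exact: leq_subr.
by rewrite subKn.
Qed.

Lemma rank_catmx_sym d : (d <= e)%N -> \rank (P d *m C) = \rank (P (e - d) *m C).
Proof.
by move=> hd; rewrite -mxrank_tr trmx_mul degproj_tr catmx_tr catmx_degproj.
Qed.

(** Transposing and moving the linear form and the projection across [C] exchanges the degrees d and
    e + 1 - d. In the extreme degrees 0 and e + 1 both ranks are 0. *)
Lemma rank_linform_sym a j d : (d <= e.+1)%N ->
  \rank (linform a j *m P d *m C) = \rank (linform a j *m P (e.+1 - d)%N *m C).
Proof.
case: d => [|d] hd.
  by rewrite subn0 linform_degproj0 degproj_gt // mulmx0.
move: hd; rewrite subSS leq_eqVlt eqSS => /orP[/eqP -> | hd].
  by rewrite subnn linform_degproj0 degproj_gt // mulmx0.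
rewrite -mxrank_tr !trmx_mul catmx_tr degproj_tr -/P -/C mulmxA catmx_degproj //.
rewrite -[in LHS]mulmxA -linform_catmx mulmxA degproj_linform.
by congr (\rank (_ *m P _ *m _)); lia.
Qed.

(* Evaluation at the point (1 : p : q), where the linear forms L = x1 - p x0 and
   U = x2 - q x0 below vanish. *)
Definition evmon (m : 'X_{1..3}) : K := p ^+ m x1 * q ^+ m x2.

Definition evcol : 'cV[K]_n := \col_i evmon (mon i).

Lemma monv_evcol m : (mdeg m <= e)%N -> monv K e m *m evcol = (evmon m)%:M.
Proof.
move=> hm; have [i <-] := mon_surj hm; rewrite monvE -rowE.
by apply/matrixP=> a b; rewrite !ord1 !mxE.
Qed.

(** The coordinate x0 is 1 at the point; d < e keeps the product from being truncated. *)
Lemma degproj_mulx0_evcol d : (d < e)%N ->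
  P d *m (mulvar K e x0 *m evcol) = P d *m evcol.
Proof.
move=> hd; apply: monv_ext => m; rewrite !mulmxA monv_degproj -!scalemxAl monv_mulvar.
case: eqP => h; last by rewrite !scale0r.
rewrite !monv_evcol ?mdegD ?mdeg1 ?h ?addn1 //; last exact: ltnW.
by rewrite /evmon !mnmDE !mnm1E !addn0.
Qed.

Let L := linform p x1.
Let U := linform q x2.

(** L and U generate the ideal of the point, so modulo them a form is its value there times x0^d.
    The induction trades one x1 for p x0, or one x2 for q x0, at a time. *)
Lemma monv_mod_linforms d m : mdeg m = d ->
  (monv K e m - evmon m *: monv K e (U_(x0) *+ d)%MM <= L *m P d + U *m P d)%MS.
Proof.
move: {2}(m x1 + m x2)%N (erefl (m x1 + m x2)%N) => s.
have step a j (m' : 'X_{1..3}) : (mdeg m').+1 = d ->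
    monv K e (m' + U_(j))%MM - a *: monv K e (m' + U_(x0))%MM
    = monv K e m' *m (linform a j *m P d).
  move=> hm'; rewrite -hm' -degproj_linform mulmxA monv_degproj eqxx scale1r.
  by rewrite /linform mulmxBr -scalemxAr !monv_mulvar.
elim: s m => [|s IH] m hs hm.
  have -> : m = (U_(x0) *+ d)%MM.
    have := hm; rewrite mdeg3 => hm3.
    apply: mnm3P; rewrite mulmnE mnm1E /=; lia.
  by rewrite /evmon !mulmnE !mnm1E /= !mul0n expr0 mulr1 scale1r subrr sub0mx.
have key a j : j != x0 -> (0 < m j)%N ->
    evmon m = a * evmon (m - U_(j) + U_(x0))%MM ->
    (linform a j *m P d <= L *m P d + U *m P d)%MS ->
    (monv K e m - evmon m *: monv K e (U_(x0) *+ d)%MM <= L *m P d + U *m P d)%MS.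
  move=> hj mj hev hsub.
  have em : (m - U_(j) + U_(j))%MM = m.
    by apply: submK; apply/mnm_lepP => i; rewrite mnm1E; case: eqP => // <-.
  have dm : (mdeg (m - U_(j))%MM).+1 = d by rewrite -hm -[in RHS]em mdegD mdeg1 addn1.
  have hs' : ((m - U_(j) + U_(x0))%MM x1 + (m - U_(j) + U_(x0))%MM x2 = s)%N.
    have hd' : mdeg (m - U_(j) + U_(x0))%MM = d by rewrite mdegD mdeg1 addn1.
    have h0 : (m - U_(j) + U_(x0))%MM x0 = (m x0).+1.
      by rewrite mnmDE mnmBE !mnm1E eqxx (negPf hj) subn0 addn1.
    have := hd'; have := hm; rewrite !mdeg3 h0; lia.
  have := IH _ hs'; rewrite mdegD mdeg1 addn1 => /(_ dm) IH'.
  have -> : monv K e m - evmon m *: monv K e (U_(x0) *+ d)%MM =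
     (monv K e (m - U_(j) + U_(j))%MM - a *: monv K e (m - U_(j) + U_(x0))%MM) +
     a *: (monv K e (m - U_(j) + U_(x0))%MM
           - evmon (m - U_(j) + U_(x0))%MM *: monv K e (U_(x0) *+ d)%MM).
    by rewrite em hev scalerBr scalerA addrA subrK.
  rewrite step // addmx_sub ?scalemx_sub //.
  exact: submx_trans (submxMl _ _) hsub.
case: (posnP (m x1)) => h1.
  apply: (key q x2) => //; [lia | | exact: addsmxSr].
  rewrite /evmon !mnmDE !mnmBE !mnm1E /= !addn0 !subn0 mulrCA -exprS.
  by congr (_ * _ ^+ _); lia.
apply: (key p x1) => //; last exact: addsmxSl.
rewrite /evmon !mnmDE !mnmBE !mnm1E /= !addn0 !subn0 mulrA -exprS.
by congr (_ ^+ _ * _); lia.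
Qed.

Lemma degproj_mod_linforms d (v : 'rV[K]_n) : v *m P d = v ->
  (v - v *m evcol *m monv K e (U_(x0) *+ d)%MM <= L *m P d + U *m P d)%MS.
Proof.
move=> hv; set W := (L *m _ + _)%MS; rewrite -{}hv (row_sum_delta v).
elim/big_rec: _ => [|i u _ IH].
  by rewrite !mul0mx subr0 sub0mx.
rewrite !mulmxDl opprD addrACA addmx_sub //.
rewrite -!scalemxAl -scalerBr scalemx_sub // -monvE monv_degproj.
case: eqP => [h|_]; last by rewrite scale0r !mul0mx subr0 sub0mx.
rewrite scale1r monv_evcol ?mdeg_mon // mul_scalar_mx.
exact: monv_mod_linforms.
Qed.

(* The dimension of the degree d piece of A/LA. *)
Definition linform_drop d : nat := \rank (P d *m C) - \rank (L *m P d *m C).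

Lemma linform_dropD d : (d <= e.+1)%N ->
  (linform_drop d + \rank (P (e.+1 - d)%N *m C) = 
   \rank (P d *m C) + linform_drop (e.+1 - d))%N.
Proof.
move=> hd; rewrite /linform_drop.
have e1 : \rank (L *m P d *m C) = \rank (L *m P (e.+1 - d)%N *m C).
  exact: rank_linform_sym.
have : (\rank (L *m P d *m C) <= \rank (P d *m C))%N by rewrite -mulmxA mxrankM_maxr.
have : (\rank (L *m P (e.+1 - d)%N *m C) <= \rank (P (e.+1 - d)%N *m C))%N.
  by rewrite -mulmxA mxrankM_maxr.
rewrite -e1; lia.
Qed.

Variables (t : nat) (f : 'rV[K]_n).
Hypotheses (ft : f *m P t = f) (fC : f *m C = 0) (f_neq0 : f *m evcol != 0).

(** Take f x0^j: it is still a relation of A and has the same value at the point. *)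
Lemma apolar_shift j : (t + j <= e)%N -> exists g : 'rV[K]_n,
  [/\ g *m P (t + j) = g, g *m C = 0 & g *m evcol = f *m evcol].
Proof.
elim: j => [|j IH] hj; first by exists f; rewrite addn0.
have [|g [g1 g2 g3]] := IH; first by lia.
exists (g *m mulvar K e x0); split.
- by rewrite addnS -mulmxA -degproj_mulvar mulmxA g1.
- by rewrite -mulmxA mulvar_catmx mulmxA g2 mul0mx.
- by rewrite -g1 -!mulmxA degproj_mulx0_evcol ?mulmxA ?g1 ?g3 //; lia.
Qed.

(** A relation g of degree d is its value at the point times x0^d modulo L and U. That value is not
    0, so x0^d lies in L A + U A, and with it every monomial of degree d. *)
Lemma catmx_sub_linforms d : (t <= d <= e)%N ->
  (P d *m C <= L *m P d *m C + U *m P d *m C)%MS.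
Proof.
move=> /andP[td de].
have [|g [g1 g2 g3]] := @apolar_shift (d - t); first by lia.
rewrite subnKC // in g1.
have gE : g *m evcol = ((f *m evcol) 0 0)%:M by rewrite g3 -mx11_scalar.
have ne0 : (f *m evcol) 0 0 != 0.
  by apply: contraNneq f_neq0 => h; rewrite [f *m _]mx11_scalar h raddf0.
have hx : (monv K e (U_(x0) *+ d)%MM *m C <= L *m P d *m C + U *m P d *m C)%MS.
  have := submxMr C (degproj_mod_linforms g1).
  rewrite addsmxMr mulmxBl g2 sub0r gE mul_scalar_mx -scalemxAl -scaleNr.
  by rewrite eqmx_scale // oppr_eq0.
apply/row_subP => i; rewrite rowE -monvE mulmxA monv_degproj.
rewrite -scalemxAl; case: eqP => [h|_]; last by rewrite scale0r sub0mx.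
rewrite scale1r; have := submxMr C (monv_mod_linforms h).
rewrite addsmxMr mulmxBl -scalemxAl => hm.
rewrite -[X in (X <= _)%MS](subrK (evmon (mon i) *: (monv K e (U_(x0) *+ d)%MM *m C))).
by rewrite addmx_sub // scalemx_sub.
Qed.

Lemma catmx_quotient_noninc d : (t <= d.+1 <= e)%N ->
  (\rank (P d.+1 *m C) + \rank (L *m P d *m C) <=
   \rank (P d *m C) + \rank (L *m P d.+1 *m C))%N.
Proof.
(* After [C], multiplication by U acts on the right as [U^T]; it maps A_d / L A_(d-1) onto A_(d+1) /
   L A_d. *)
move=> hd; apply: (rank_drop_le (U := U^T)).
- by rewrite -mulmxA submxMl.
- by rewrite -[P d *m C *m _]mulmxA -linform_catmx mulmxA degproj_linform catmx_sub_linforms.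
- rewrite -mulmxA -linform_catmx mulmxA -[L *m _ *m U]mulmxA degproj_linform.
  by rewrite mulmxA linformC -!mulmxA submxMl.
Qed.

Lemma linform_drop_le d : (t <= d.+1 <= e.+1)%N ->
  (linform_drop d.+1 <= linform_drop d)%N.
Proof.
move=> /andP[td]; rewrite leq_eqVlt eqSS ltnS /linform_drop => /orP[/eqP -> | de].
  by rewrite degproj_gt // mul0mx mxrank0.
have := @catmx_quotient_noninc d; rewrite td de => /(_ isT).
have : (\rank (L *m P d *m C) <= \rank (P d *m C))%N by rewrite -mulmxA mxrankM_maxr.
have : (\rank (L *m P d.+1 *m C) <= \rank (P d.+1 *m C))%N.
  by rewrite -mulmxA mxrankM_maxr.
lia.
Qed.

End LinearForms.

(** * Extension of the base field *)

Section HilbertFunction.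
Local Open Scope ring_scope.

Definition cat_hilbert (k : fieldType) (e : nat) (phi : 'X_{1..3} -> k) d : nat :=
  \rank (degproj k e d *m catmx e phi).

Lemma rank_degproj (k : fieldType) (e d : nat) : (d <= e)%N ->
  \rank (degproj k e d) = 'C(d + 2, d).
Proof.
move=> hd; rewrite -(size_basis 2 d).
have := uniq_basis 3 d; have := @basis_cover 3 d.
move: [seq _ | _ <- _] => s hs us.
pose B := \matrix_(a < size s) monv k e (nth 0%MM s a).
have degs (a : 'I_(size s)) : mdeg (nth 0%MM s a) = d.
  by apply/eqP; rewrite hs mem_nth.
(* The rows are distinct unit vectors, so [B *m B^T] is the identity. *)
have fB : row_free B.
  apply/row_freeP; exists B^T; apply/matrixP => a b.
  have -> : (B *m B^T) a b = (monv k e (nth 0%MM s a) *m (monv k e (nth 0%MM s b))^T) 0 0.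
    by rewrite !mxE; apply: eq_bigr => j _; rewrite !mxE.
  have [|i hi] := @mon_surj e (nth 0%MM s a); first by rewrite degs.
  rewrite -hi monvE -rowE !mxE hi -val_eqE /=; congr (nat_of_bool _)%:R.
  exact: (nth_uniq 0%MM (ltn_ord a) (ltn_ord b) us).
have -> : \rank (degproj k e d) = \rank B.
  apply/eqmx_rank/andP; split; apply/row_subP => i.
    rewrite rowE -monvE monv_degproj; case: eqP => [h|_]; last by rewrite scale0r sub0mx.
    have /(nthP 0%MM)[a ha <-] : mon i \in s by rewrite -hs h.
    by rewrite scale1r -(rowK (fun a : 'I_(size s) => monv k e (nth 0%MM s a)) (Ordinal ha)) row_sub.
  rewrite rowK -[monv _ _ _]scale1r -[1]/(true%:R) -(introT eqP (degs i)) -monv_degproj.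
  exact: submxMl.
by apply/eqP.
Qed.

Lemma cat_hilbert_relation (k : fieldType) (e : nat) (phi : 'X_{1..3} -> k) d :
  (d <= e)%N -> cat_hilbert e phi d != 'C(d + 2, d) ->
  exists f : 'rV[k]_#|{: 'X_{1..3 < e.+1}}|,
    [/\ f *m degproj k e d = f, f *m catmx e phi = 0 & f != 0].
Proof.
move=> hd; rewrite -(rank_degproj k hd) /cat_hilbert => hr.
have /rowV0Pn[f] : (degproj k e d :&: kermx (catmx e phi))%MS != 0.
  apply: contraNneq hr => h0.
  by rewrite -(mxrank_mul_ker (degproj k e d) (catmx e phi)) h0 mxrank0 addn0.
rewrite sub_capmx => /andP[/submxP[w ->] /sub_kermxP fC f0]; exists (w *m degproj k e d).
split=> //; rewrite -mulmxA; congr (_ *m _).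
apply: monv_ext => m; rewrite mulmxA !monv_degproj -scalemxAl monv_degproj scalerA.
by case: eqP; rewrite ?mul0r ?mulr1.
Qed.

Lemma map_degproj (k K : fieldType) (g : {rmorphism k -> K}) e d :
  map_mx g (degproj k e d) = degproj K e d.
Proof. by apply/matrixP => i j; rewrite !mxE rmorph_nat. Qed.

Lemma map_catmx (k K : fieldType) (g : {rmorphism k -> K}) e phi :
  map_mx g (catmx e phi) = catmx e (g \o phi).
Proof. by apply/matrixP => i j; rewrite !mxE; case: ifP; rewrite // rmorph0. Qed.

Lemma cat_hilbert_map (k K : fieldType) (g : {rmorphism k -> K}) e phi d :
  cat_hilbert e (g \o phi) d = cat_hilbert e phi d.
Proof. by rewrite /cat_hilbert -(map_degproj g) -map_catmx -map_mxM mxrank_map. Qed.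

(* Kronecker substitution: distinct monomials of the same degree <= e take
   distinct values at the point (1 : X : X^(e+1)). *)
Lemma kronecker_neq0 (k : fieldType) (e t : nat)
    (f : 'rV[k]_#|{: 'X_{1..3 < e.+1}}|) :
  f *m degproj k e t = f -> f != 0 ->
  map_mx (@FracField.tofrac {poly k} \o polyC) f
    *m evcol e (FracField.tofrac 'X) (FracField.tofrac ('X ^+ e.+1)) != 0.
Proof.
move=> ft f0.
have [i0 fi0] : exists i, f 0 i != 0.
  apply/existsP; apply: contraNT f0; rewrite negb_exists => /forallP h.
  by apply/eqP/rowP => i; rewrite mxE; apply/eqP/negPn.
have fdeg i : f 0 i != 0 -> mdeg (mon i) = t.
  move=> fi; apply/eqP; apply: contraNT fi => hi.
  rewrite -ft mxE big1 // => j _; rewrite mxE; case: (eqVneq j i) => [->|//] /=.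
    by rewrite (negPf hi) mulr0.
  by rewrite mulr0.
(* The exponent of X in the value of a monomial: its digits in base e + 1 are the exponents of x1
   and x2, and the degree t fixes that of x0. *)
pose w (i : 'I_#|{: 'X_{1..3 < e.+1}}|) : nat :=
  (mon i (@Ordinal 3 1 isT) + e.+1 * mon i (@Ordinal 3 2 isT))%N.
have winj i : f 0 i != 0 -> w i = w i0 -> i = i0.
  move=> fi hw; have := fdeg _ fi; have := fdeg _ fi0; rewrite !mdeg3 => h1 h2.
  have := mdeg_mon i; have := mdeg_mon i0; rewrite !mdeg3 => h3 h4.
  have h5 : mon i (@Ordinal 3 1 isT) = mon i0 (@Ordinal 3 1 isT).
    have := congr1 (modn^~ e.+1) hw.
    by rewrite /w /= ![(_ + e.+1 * _)%N]addnC ![(e.+1 * _)%N]mulnC !modnMDl !modn_small //; lia.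
  have h6 : mon i (@Ordinal 3 2 isT) = mon i0 (@Ordinal 3 2 isT).
    by move: hw; rewrite /w h5 => /addnI/eqP; rewrite eqn_pmul2l // => /eqP.
  by apply: (@mon_inj e); apply: mnm3P => //; lia.
pose F : {poly k} := \sum_i f 0 i *: 'X^(w i).
have F0 : F != 0.
  apply: contraNneq fi0 => hF; have := congr1 (fun G : {poly k} => G`_(w i0)) hF.
  rewrite coef0 coef_sum (bigD1 i0) //= big1 ?addr0 => [|i hi].
    by rewrite coefZ coefXn eqxx mulr1 => ->.
  rewrite coefZ coefXn; case: eqP => [h|_]; last by rewrite mulr0.
  case: (eqVneq (f 0 i) 0) => [->|fi]; first by rewrite mul0r.
  by rewrite (winj _ fi (esym h)) eqxx in hi.
apply: contraNneq F0 => h; rewrite -tofrac_eq0.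
have <- : (map_mx (@FracField.tofrac {poly k} \o polyC) f
    *m evcol e (FracField.tofrac 'X) (FracField.tofrac ('X ^+ e.+1))) 0 0 = FracField.tofrac F.
  rewrite mxE rmorph_sum /=; apply: eq_bigr => i _.
  by rewrite !mxE /= /evmon -mul_polyC rmorphM /= exprD exprM rmorphM !rmorphXn.
by rewrite h mxE.
Qed.

(** c_d is the dimension of (A/LA)_d over k(X); only natural numbers are returned, so the field
    extension stays hidden from the rest of the proof. *)
Lemma cat_hilbert_drop (k : fieldType) (e : nat) (phi : 'X_{1..3} -> k) (t : nat)
    (f : 'rV[k]_#|{: 'X_{1..3 < e.+1}}|) :
  f *m degproj k e t = f -> f *m catmx e phi = 0 -> f != 0 ->
  exists c : nat -> nat,
    [/\ forall d, (d <= e.+1)%N ->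
          (c d + cat_hilbert e phi (e.+1 - d) = cat_hilbert e phi d + c (e.+1 - d))%N,
        forall d, (c d <= cat_hilbert e phi d)%N
      & forall d, (t <= d.+1 <= e.+1)%N -> (c d.+1 <= c d)%N].
Proof.
move=> ft fC f0; pose K := {fraction {poly k}}.
pose g : {rmorphism k -> K} := (@FracField.tofrac {poly k} \o polyC).
pose p : K := FracField.tofrac 'X; pose q : K := FracField.tofrac ('X ^+ e.+1).
exists (linform_drop e (g \o phi) p); split => d.
- by move=> hd; rewrite -!(cat_hilbert_map g); exact: linform_dropD.
- by rewrite -(cat_hilbert_map g) leq_subr.
- apply: (@linform_drop_le _ _ _ p q t (map_mx g f)).
  + by rewrite -(map_degproj g) -map_mxM ft.
  + by rewrite -map_catmx -map_mxM fC map_mx0.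
  + exact: kronecker_neq0 ft f0.
Qed.

Lemma cat_hilbert_sym (k : fieldType) (e : nat) (phi : 'X_{1..3} -> k) d :
  (d <= e)%N -> cat_hilbert e phi d = cat_hilbert e phi (e - d).
Proof. exact: rank_catmx_sym. Qed.

Lemma cat_hilbert_gt (k : fieldType) (e : nat) (phi : 'X_{1..3} -> k) d :
  (e < d)%N -> cat_hilbert e phi d = 0%N.
Proof. by move=> hd; rewrite /cat_hilbert degproj_gt // mul0mx mxrank0. Qed.

End HilbertFunction.

(** * O-sequences of codimension two *)

Section OSequences.

(** The expansion consists of n binomials C(i - t, i - t), each of which stays 1 when both entries
    are raised. *)
Lemma macaulay_up_small i n : 0 < i -> n <= i -> macaulay_up n i = n.
Proof.
move=> i0 ni.
have hb : is_binexp i n (mkseq (fun t => i - t) n).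
  apply/and4P; split; rewrite ?size_mkseq //.
  - apply/(sortedP 0) => j; rewrite size_mkseq => hj.
    by rewrite !nth_mkseq //; lia.
  - case: n ni => [|n] ni; first by rewrite /= leq_subr.
    by rewrite -nth_last size_mkseq nth_mkseq.
  - apply/eqP; rewrite -[LHS]card_ord -sum1_card; apply: eq_bigr => j _.
    by rewrite nth_mkseq // binn.
rewrite /macaulay_up (is_binexp_uniq (binexpP n i0) hb) size_mkseq.
rewrite -[RHS]card_ord -sum1_card; apply: eq_bigr => j _.
by rewrite nth_mkseq // binn.
Qed.

Lemma macaulay_up_succ i : 0 < i -> macaulay_up i.+1 i = i.+2.
Proof.
move=> i0.
have hb : is_binexp i i.+1 [:: i.+1].
  by rewrite /is_binexp /= big_ord_recl big_ord0 /= !subn0 addn0 i0 leqnSn binSn eqxx.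
by rewrite /macaulay_up (is_binexp_uniq (binexpP i.+1 i0) hb) big_ord_recl big_ord0
   /= subn0 addn0 binSn.
Qed.

(** From degree t on the entries satisfy d_j <= j, where the Macaulay bound is d_j itself; below t
    it is j + 2. *)
Lemma O_sequence_codim2 (d : nat -> nat) (t N : nat) :
  0 < t -> 0 < N -> (forall j, j < t -> j < N -> d j = j.+1) ->
  (forall j, t <= j.+1 -> j.+1 < N -> d j.+1 <= d j) ->
  O_sequence (mkseq d N).
Proof.
move=> t0 N0 dlt dge.
have dle j : t <= j -> j < N -> d j <= j.
  elim: j => [|j IH] tj jN; first by move: t0; rewrite ltnNge tj.
  apply: leq_trans (dge _ tj jN) _.
  case: (ltnP j t) => jt; first by rewrite dlt //; lia.
  by have := IH jt (ltnW jN); lia.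
split; first by rewrite nth_mkseq // dlt.
move=> j j0; rewrite size_mkseq => jN; rewrite !nth_mkseq //; last exact: ltnW.
case: (ltnP j t) => jt.
  rewrite (dlt j) //; last exact: ltnW.
  rewrite macaulay_up_succ //; case: (ltnP j.+1 t) => j1t; first by rewrite dlt.
  by apply: leq_trans (dle _ j1t jN) _.
rewrite macaulay_up_small //; last by apply: dle => //; exact: ltnW.
by apply: dge => //; exact: ltnW.
Qed.

Lemma SI_sequence_from_differences (h : seq nat) (d : nat -> nat) (t e : nat) :
  size h = e.+1 -> (forall i, i <= e -> nth 0 h i = nth 0 h (e - i)) ->
  0 < t -> nth 0 h 0 = d 0 ->
  (forall j, j < e./2 -> nth 0 h j.+1 = nth 0 h j + d j.+1) ->
  (forall j, j < t -> j <= e./2 -> d j = j.+1) ->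
  (forall j, t <= j.+1 -> j < e./2 -> d j.+1 <= d j) ->
  SI_sequence h.
Proof.
move=> sh hsym t0 h0 hd dlt dge; rewrite /SI_sequence sh /=; split=> //.
have hM : e./2 <= e by lia.
have st : size (take e./2.+1 h) = e./2.+1.
  by rewrite size_take sh ltnS; case: ltnP => //; lia.
split; first by rewrite nth_take // h0 dlt.
exists (mkseq d e./2.+1); last exact: (@O_sequence_codim2 d t e./2.+1).
apply: (@eq_from_nth _ 0%R).
  by rewrite size_pairmap size_map size_mkseq st.
rewrite size_pairmap st => j hj.
rewrite (nth_pairmap 0) ?st // (nth_map 0) ?size_mkseq // nth_mkseq // nth_take //.
case: j hj => [|j] hj /=; first by rewrite subr0 h0.
by rewrite nth_take ?(ltnW hj) // hd // PoszD addrC addKr.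
Qed.

Lemma cat_hilbert_SI (k : fieldType) (e : nat) (phi : 'X_{1..3} -> k) (h : seq nat) :
  size h = e.+1 -> nth 0 h 0 = 1 ->
  (forall i, i <= e -> nth 0 h i = cat_hilbert e phi i) -> SI_sequence h.
Proof.
move=> sh h0 hH; pose H := cat_hilbert e phi.
have hsym i : i <= e -> nth 0 h i = nth 0 h (e - i).
  by move=> hi; rewrite !hH ?leq_subr //; exact: cat_hilbert_sym.
have Hsym i : i <= e -> H i = H (e - i) by exact: cat_hilbert_sym.
have H0 : H 0 = 1 by rewrite -h0 hH.
have binD j : 'C(j.+1 + 2, j.+1) = 'C(j + 2, j) + j.+2.
  by rewrite addSn binS addnC addn2 binSn.
pose d j := if j is j'.+1 then H j - H j' else 1.
have hM : e./2 <= e by lia.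
have dfull t j : (forall i, i < t -> i <= e./2 -> H i = 'C(i + 2, i)) ->
    j < t -> j <= e./2 -> d j = j.+1.
  move=> hbin; case: j => [//|j] jt jM; rewrite /d !hbin ?binD ?addKn //; lia.
(* Either A has a relation of degree at most e/2, and t is the least such degree, or it agrees with
   the polynomial ring up to e/2. *)
case: (boolP [exists i : 'I_e./2.+1, H i != 'C(i + 2, i)]) => [|/existsPn hfull].
  move=> /existsP[i0 hi0].
  have [|t /andP[ht htne] tmin] := @ex_minnP (fun i => (i <= e./2) && (H i != 'C(i + 2, i))).
    by exists i0; rewrite -ltnS ltn_ord.
  have hbin i : i < t -> i <= e./2 -> H i = 'C(i + 2, i).
    move=> it iM; apply/eqP/negPn/negP => hne.
    by have := tmin i; rewrite iM hne => /(_ isT); rewrite leqNgt it.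
  have t0 : 0 < t by case: (posnP t) htne => [->|//]; rewrite H0.
  have [f [f1 f2 f3]] := cat_hilbert_relation (leq_trans ht hM) htne.
  have [c [c1 c2 c3]] := cat_hilbert_drop f1 f2 f3; rewrite -/H in c1 c2.
  have cmono a b : t <= a.+1 -> a <= b -> b <= e.+1 -> c b <= c a.
    move=> ta; elim: b => [|b IH] ab be; first by move: ab; rewrite leqn0 => /eqP->.
    move: ab; rewrite leq_eqVlt => /orP[/eqP-> //|ab].
    by apply: leq_trans (c3 b _) (IH _ _); lia.
  have ce : c e.+1 = 0.
    by apply/eqP; rewrite -leqn0; apply: leq_trans (c2 _) _; rewrite /H cat_hilbert_gt.
  have c0 : c 0 = 1.
    by have := c1 0 isT; rewrite subn0 ce H0 /H cat_hilbert_gt // !addn0.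
  have Hc j : j < e -> H j + c j.+1 = H j.+1 + c (e - j).
    move=> je; have := c1 j.+1; rewrite subSS (Hsym (e - j)) ?leq_subr // subKn ?(ltnW je) //.
    by rewrite ltnS (ltnW je) => /(_ isT); lia.
  (* Since j < e/2, degree e - j lies beyond j + 1, so c_(e-j) <= c_(j+1). *)
  have hmono j : t <= j.+1 -> j < e./2 -> H j <= H j.+1.
    move=> tj jM; have := cmono j.+1 (e - j); have := Hc j.
    lia.
  have Hmono j : j < e./2 -> H j <= H j.+1.
    move=> jM; case: (ltnP j.+1 t) => tj; last exact: hmono.
    by rewrite !hbin ?binD ?leq_addr //; lia.
  (* d_j = c_j - c_(e+1-j), stated additively; at j = 0 it reads 1 = 1 - 0. *)
  have dc j : t <= j.+1 -> j <= e./2 -> d j + c (e.+1 - j) = c j.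
    case: j => [|j] tj jM; first by rewrite /d subn0 ce c0.
    rewrite /d subSS; have := Hmono _ jM; have := Hc j; lia.
  apply: (@SI_sequence_from_differences h d t e) => //.
  - by move=> j jM; rewrite !hH ?subnKC ?Hmono //; lia.
  - by move=> j; apply: dfull.
  (* From j to j + 1 the term c_j does not grow, while the subtracted c_(e+1-j) becomes c_(e-j),
     which is no smaller. *)
  - move=> j tj jM; have := dc _ tj (ltnW jM); have := dc j.+1 (leqW tj) jM.
    have := cmono (e - j) (e.+1 - j); have := c3 j; rewrite subSS; lia.
(* Without relations up to e/2 the choice t = e/2 + 1 leaves no decreasing stretch. *)
have hbin i : i < e./2.+1 -> i <= e./2 -> H i = 'C(i + 2, i).
  by move=> hi _; apply/eqP/negPn/(hfull (Ordinal hi)).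
apply: (@SI_sequence_from_differences h d e./2.+1 e) => //.
- move=> j jM; rewrite !hH; try lia.
  by rewrite -/H /d subnKC // !hbin ?binD ?leq_addr //; lia.
- by move=> j; apply: dfull.
- by move=> j; lia.
Qed.

End OSequences.

(** * From the algebra to its dual form *)

Section Dimension.
Local Open Scope ring_scope.
Variables (k : fieldType) (V : lmodType k).

Lemma has_dim_le (S : V -> Prop) m n : has_dim S m -> has_dim S n -> (m <= n)%N.
Proof.
move=> [b [Sb fb _]] [b' [_ _ gb']].
have /fin_all_exists[A hA] i : exists c : 'I_n -> k, b i = \sum_j c j *: b' j.
  exact: gb' (Sb i).
pose M : 'M_(m, n) := \matrix_(i, j) A i j.
rewrite leqNgt; apply/negP => nm.
have /rowV0Pn[v /sub_kermxP vM v0] : kermx M != 0.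
  rewrite -mxrank_eq0 mxrank_ker subn_eq0 -ltnNge.
  exact: leq_ltn_trans (rank_leq_col M) nm.
case/eqP: v0; apply/rowP => i; rewrite mxE; apply: (fb (fun i => v 0 i)).
under eq_bigr => i' _ do rewrite hA scaler_sumr.
rewrite exchange_big big1 //= => j _.
under eq_bigr => i' _ do rewrite scalerA.
have := congr1 (fun u : 'rV_n => u 0 j) vM; rewrite !mxE.
rewrite -scaler_suml; under eq_bigr => i1 _ do rewrite mxE.
by move=> ->; rewrite scale0r.
Qed.

Lemma has_dim_uniq (S : V -> Prop) m n : has_dim S m -> has_dim S n -> m = n.
Proof. by move=> hm hn; apply/eqP; rewrite eqn_leq !(has_dim_le hm hn, has_dim_le hn hm). Qed.

Lemma has_dim0 (S : V -> Prop) v : has_dim S 0 -> S v -> v = 0.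
Proof. by move=> [b [_ _ gb]] /gb[c ->]; rewrite big_ord0. Qed.

(** The family w spans S and its linear relations are the left kernel of [M], so S is isomorphic to
    the row space of [M]. The matrix D lifts a basis of that row space to combinations of w. *)
Lemma has_dim_rank (S : V -> Prop) n p (w : 'I_n -> V) (M : 'M[k]_(n, p)) :
  (forall v : 'rV_n, \sum_i v 0 i *: w i = 0 <-> v *m M = 0) ->
  (forall a, S a <-> exists v : 'rV_n, a = \sum_i v 0 i *: w i) ->
  has_dim S (\rank M).
Proof.
move=> hker hS.
have /submxP[D hD] : (row_base M <= M)%MS by rewrite eq_row_base.
have comb (c : 'I_(\rank M) -> k) : \sum_i c i *: (\sum_j D i j *: w j)
    = \sum_j ((\row_i c i) *m D) 0 j *: w j.
  under eq_bigr => i _ do rewrite scaler_sumr.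
  rewrite exchange_big; apply: eq_bigr => j _ /=.
  under eq_bigr => i _ do rewrite scalerA.
  by rewrite -scaler_suml mxE; congr (_ *: _); apply: eq_bigr => i _; rewrite mxE.
exists (fun i => \sum_j D i j *: w j); split.
- by move=> i; apply/hS; exists (row i D); apply: eq_bigr => j _; rewrite mxE.
- move=> c; rewrite comb => /hker; rewrite -mulmxA -hD => h0 i.
  have : (\row_i c i) *m row_base M = 0 *m row_base M by rewrite h0 mul0mx.
  by move=> /(row_free_inj (row_base_free M))/rowP/(_ i); rewrite !mxE.
- move=> a /hS[v ->].
  have /submxP[c hc] : (v *m M <= row_base M)%MS by rewrite eq_row_base submxMl.
  exists (fun i => c 0 i); rewrite comb; apply/eqP; rewrite -subr_eq0 -sumrB.
  under eq_bigr => i _ do rewrite -scalerBl.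
  have -> : \row_i c 0 i = c by apply/rowP => i; rewrite mxE.
  apply/eqP; rewrite -[RHS](_ : \sum_i (v - c *m D) 0 i *: w i = 0).
    by apply: eq_bigr => i _; rewrite !mxE.
  by apply/hker; rewrite mulmxBl hc hD mulmxA subrr.
Qed.

End Dimension.

Section Gorenstein.
Local Open Scope ring_scope.
Variables (k : fieldType) (I : idealr {mpoly k[3]}).

Local Notation A := (quot_alg I).
Local Notation pr := (@qproj k 3 I).

Lemma qprojM p q : pr (p * q) = pr p * pr q.
Proof. exact: rmorphM. Qed.

Lemma qprojZ (c : k) p : pr (c *: p) = c *: pr p.
Proof. by rewrite -mul_mpolyC qprojM. Qed.

Lemma dhomogMX d (p : {mpoly k[3]}) j : p \is d.-homog -> p * 'X_j \is d.+1.-homog.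
Proof.
move=> hp; have := dhomogM hp (_ : 'X_j \is 1.-homog); rewrite addn1; apply.
by rewrite dhomogX; apply/eqP; exact: mdeg1.
Qed.

Lemma graded_pieceX m : @graded_piece k 3 I (mdeg m) (pr 'X_[m]).
Proof. by exists 'X_[m] => //; rewrite dhomogX. Qed.

Lemma socle_qproj p : (forall j, pr (p * 'X_j) = 0) -> socle (pr p).
Proof.
move=> hp b [c ->]; rewrite mulr_sumr big1 // => j _.
by rewrite mulrCA -qprojM hp mulr0.
Qed.

Variable e : nat.
Hypothesis low_socle : forall i a, (i < e)%N -> @graded_piece k 3 I i a -> socle a -> a = 0.

(* The socle sits in degree e, so an element of lower degree that is not 0 can
   be multiplied by some variable without becoming 0. *)
Lemma pairing_nondegenerate s d p : (d + s = e)%N -> p \is d.-homog ->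
  (forall m, mdeg m = s -> pr (p * 'X_[m]) = 0) -> pr p = 0.
Proof.
elim: s d p => [|s IH] d p hds hp hm.
  by have := hm 0%MM mdeg0; rewrite mpolyX0 mulr1.
apply: (low_socle (i := d)); [lia | by exists p | apply: socle_qproj => j].
apply: (IH d.+1); first lia.
  exact: dhomogMX.
by move=> m ms; rewrite -mulrA -mpolyXD hm // mdegD mdeg1 ms.
Qed.

Variables (b : A) (phi : 'X_{1..3} -> k).
Hypothesis b_neq0 : b != 0.
Hypothesis phiP : forall m, mdeg m = e -> pr 'X_[m] = phi m *: b.

Let n := #|{: 'X_{1..3 < e.+1}}|.

(** Paired with the monomials of degree e - d, the form with coefficients v gives the entries of v
    times the catalecticant. By nondegeneracy these all vanish exactly when the form is 0 in A. *)
Lemma graded_piece_cat_hilbert d : (d <= e)%N ->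
  has_dim (@graded_piece k 3 I d) (cat_hilbert e phi d).
Proof.
move=> hd.
pose form (v : 'rV[k]_n) : {mpoly k[3]} :=
  \sum_i v 0 i *: (if mdeg (mon i) == d then 'X_[mon i] else 0).
have form_homog v : form v \is d.-homog.
  apply: rpred_sum => i _; apply: rpredZ; case: eqP => [<-|_]; last exact: rpred0.
  by rewrite dhomogX.
pose w (i : 'I_n) : A := pr (if mdeg (mon i) == d then 'X_[mon i] else 0).
have formE (v : 'rV_n) : \sum_i v 0 i *: w i = pr (form v).
  by rewrite rmorph_sum; apply: eq_bigr => i _; apply/esym/qprojZ.
have pairE (v : 'rV_n) (j : 'I_n) : mdeg (mon j) = (e - d)%N ->
    pr (form v * 'X_[mon j]) = (v *m (degproj k e d *m catmx e phi)) 0 j *: b.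
  move=> hj; rewrite mulr_suml rmorph_sum mxE scaler_suml; apply: eq_bigr => i _.
  have -> : (degproj k e d *m catmx e phi) i j =
      if mdeg (mon i) == d then phi (mon i + mon j)%MM else 0.
    rewrite mxE (bigD1 i) //= big1 => [|l li]; last by rewrite mxE eq_sym (negPf li) mul0r.
    rewrite !mxE eqxx hj addr0 (_ : (_ + _ == e)%N = (mdeg (mon i) == d)).
      by case: eqP; rewrite ?mul1r ?mul0r.
    by apply/eqP/eqP; lia.
  rewrite -scalerAl -scalerA; apply: etrans (qprojZ _ _) _.
  congr (_ *: _); case: eqP => hi.
    by rewrite -mpolyXD phiP // mdegD hi hj subnKC.
  by rewrite mul0r rmorph0 scale0r.
apply: (has_dim_rank (w := w)) => [v|a].
- rewrite formE; split=> [v0 | vM].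
    apply/rowP => j; rewrite [RHS]mxE; case: (eqVneq (mdeg (mon j)) (e - d)%N) => hj.
      apply/eqP; have : (v *m (degproj k e d *m catmx e phi)) 0 j *: b == 0.
        by rewrite -pairE // qprojM v0 mul0r.
      by rewrite scaler_eq0 (negPf b_neq0) orbF.
    rewrite degproj_catmx // mulmxA mxE big1 // => i _; rewrite [degproj _ _ _ _ _]mxE.
    by case: eqP => [->|_]; rewrite /= ?(negPf hj) mulr0.
  apply: (@pairing_nondegenerate (e - d) d) => //; first exact: subnKC.
  move=> m hm; have [|j hj] := @mon_surj e m; first by rewrite hm leq_subr.
  by rewrite -hj pairE ?hj // vM mxE scale0r.
- split=> [[p hp ->] | [v ->]]; last by exists (form v) => //; rewrite formE.
  exists (\row_i p@_(mon i)); rewrite formE; congr (pr _); apply/mpolyP => m.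
  rewrite /form raddf_sum /=; case: (eqVneq (mdeg m) d) => hm; last first.
    rewrite (dhomog_nemf_coeff hp hm) big1 // => i _; rewrite mcoeffZ.
    case: eqP => hi; last by rewrite mcoeff0 mulr0.
    by rewrite mcoeffX; case: eqP => h; rewrite ?mulr0 // -h hi eqxx in hm *.
  have [|i hi] := @mon_surj e m; first by rewrite hm.
  rewrite (bigD1 i) //= big1 ?addr0 => [|j hj].
    by rewrite mxE hi hm eqxx mcoeffZ mcoeffX eqxx mulr1.
  rewrite mcoeffZ; case: ifP => _; last by rewrite mcoeff0 mulr0.
  by rewrite mcoeffX -hi (inj_eq (@mon_inj e)) (negPf hj) mulr0.
Qed.

End Gorenstein.

Section HVector.
Local Open Scope ring_scope.
Variables (k : fieldType) (I : idealr {mpoly k[3]}).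

(** Identifies h with the vector hidden in the definition of the socle vector, which gives h the
    length e + 1. *)
Lemma hvector_uniq h h' : is_hvector I h -> is_hvector I h' -> h = h'.
Proof.
move=> [l d] [l' d'].
have hE i : nth 0%N h i = nth 0%N h' i := has_dim_uniq (d i) (d' i).
have size_le (s s' : seq nat) : last 0%N s != 0%N ->
    (forall i, nth 0%N s i = nth 0%N s' i) -> (size s <= size s')%N.
  move=> ls ss'; rewrite leqNgt; apply: contraNN ls => lt.
  by rewrite -nth_last ss' nth_default //; lia.
apply: (@eq_from_nth _ 0%N) => [|i _]; last exact: hE.
by apply/eqP; rewrite eqn_leq !size_le.
Qed.

Lemma gorenstein_dual_form h : gorenstein I -> is_hvector I h ->
  exists e (phi : 'X_{1..3} -> k), [/\ size h = e.+1, (0 < nth 0%N h 0)%N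
    & forall d, (d <= e)%N -> nth 0%N h d = cat_hilbert e phi d].
Proof.
move=> [e [h' [hh' sz soc]]] hh; rewrite -(hvector_uniq hh hh') {h' hh'} in sz.
have {}sz : size h = e.+1 by rewrite -sz size_rcons size_nseq.
have [lasth dimh] := hh.
have low i a : (i < e)%N -> @graded_piece k 3 I i a -> socle a -> a = 0.
  move=> ie ga sa; have := soc i; rewrite size_rcons size_nseq nth_rcons size_nseq ie nth_nseq ie.
  by move=> /(_ (leqW ie))/has_dim0; apply.
(* A vanishes in degree e + 1, so all of A_e is socle, hence a line spanned by b. *)
have topsoc a : @graded_piece k 3 I e a -> socle a.
  move=> [p hp ->]; apply: socle_qproj => j; have := dimh e.+1.
  rewrite nth_default ?sz // => /has_dim0; apply; exists (p * 'X_j) => //.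
  exact: dhomogMX.
have := soc e; rewrite size_rcons size_nseq ltnSn nth_rcons size_nseq ltnn eqxx.
move=> /(_ isT)[bb [bS bfree bspan]]; pose b := bb ord0.
have b0 : b != 0.
  apply: contraTneq (oner_neq0 k) => hb; apply/negPn/eqP.
  by apply: (bfree (fun=> 1) _ 0); rewrite big_ord1 -/b hb scaler0.
(* The implication is vacuous outside degree e, so a choice exists for every monomial. *)
have hphi m : exists c : k, (mdeg m == e) ==> (qproj I 'X_[m] == c *: b).
  case: eqP => [me|_]; last by exists 0.
  have gm : @graded_piece k 3 I e (qproj I 'X_[m]) by rewrite -me; exact: graded_pieceX.
  by have [c ->] := bspan _ (conj gm (topsoc _ gm)); exists (c ord0); rewrite big_ord1 eqxx.
pose phi m := xchoose (hphi m).
have phiP m : mdeg m = e -> qproj I 'X_[m] = phi m *: b.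
  by move=> me; apply/eqP; have /implyP := xchooseP (hphi m); apply; apply/eqP.
exists e, phi; split=> // [|d de]; last first.
  exact: has_dim_uniq (dimh d) (graded_piece_cat_hilbert low b0 phiP de).
have h0E := has_dim_uniq (dimh 0%N) (graded_piece_cat_hilbert low b0 phiP (leq0n e)).
(* By symmetry h_0 equals h_e, the last entry of h, which is not 0. *)
rewrite h0E cat_hilbert_sym // subn0.
rewrite -(has_dim_uniq (dimh e) (graded_piece_cat_hilbert low b0 phiP (leqnn e))).
by rewrite lt0n -[e]/(e.+1.-1) -sz nth_last.
Qed.

End HVector.

Theorem theorem4 (k : fieldType) (h : seq nat) :
  gorenstein_hvector k 3 h -> SI_sequence h.
Proof.
move=> [I [_ _ _ gorI hvI]].
have [e [phi [sz h0 hphi]]] := gorenstein_dual_form gorI hvI.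
apply: (cat_hilbert_SI sz _ hphi).
(* There is only one monomial of degree 0, so h_0 is at most 1. *)
apply/eqP; rewrite eqn_leq h0 andbT hphi // /cat_hilbert.
by apply: leq_trans (mxrankM_maxl _ _) _; rewrite rank_degproj.
Qed.
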